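(* For every $s\ge 0$, $$B(s,-\infty)>0 .$$
   Context: Let $W$ be a standard one-dimensional Wiener process on a probability space $(\Omega,\mathcal F,\mathbb P)$ with $W(0)=0$, and let $\sigma>0$. For $s\ge 0$ and $x\in\mathbb R$, let $X_{s,t}(x)$, $t\ge s$, denote the unique local solution of the stochastic differential equation $$dX(t)=X(t)\big(X(t)-t\big)\,dt+\sigma\,dW(t),\quad t\ge s,\qquad X(s)=x.$$ The blow-up time is $\beta_s(x):=\lim_{n\to\infty}\inf\{t>s:\ |X_{s,t}(x)|\ge n\}\in(s,\infty]$, and $B(s,x):=\mathbb P(\beta_s(x)<\infty)$. The function $x\mapsto B(s,x)$ is non-decreasing, and $B(s,-\infty):=\lim_{x\to-\infty}B(s,x)$. *)

(* Defs.v *)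
From HB Require Import structures.
From mathcomp Require Import all_boot all_order all_algebra.
From mathcomp Require Import all_classical all_reals all_analysis.

Set Implicit Arguments.
Unset Strict Implicit.
Unset Printing Implicit Defensive.

Import Order.TTheory GRing.Theory Num.Theory.
Import numFieldNormedType.Exports.

Local Open Scope classical_set_scope.
Local Open Scope ring_scope.

(* Time is [0, +oo[; the values of W at negative times are irrelevant.
   The second parameter of normal_prob is the standard deviation. *)
Record wiener_process {R : realType} {d : measure_display}
    {Omega : measurableType d} (P : probability Omega R)
    (W : R -> Omega -> R) : Prop := WienerProcess {
  wiener_measurable : forall t : R, 0 <= t -> measurable_fun [set: Omega] (W t) ;
  wiener0 : forall omega : Omega, W 0 omega = 0 ;
  wiener_continuous : forall omega : Omega,
    {within `[0, +oo[, continuous (W ^~ omega)} ;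
  wiener_normal : forall s t : R, 0 <= s -> s < t ->
    forall A : set R, measurable A ->
      P ((W t \- W s) @^-1` A) = normal_prob 0 (Num.sqrt (t - s)) A ;
  wiener_independent : forall (n : nat) (t : nat -> R) (A : nat -> set R),
    0 <= t 0%N -> (forall i, t i <= t i.+1) -> (forall i, measurable (A i)) ->
    P (\bigcap_(i < n) ((W (t i.+1) \- W (t i)) @^-1` A i)) =
    (\prod_(i < n) P ((W (t i.+1) \- W (t i))%R @^-1` A i))%E }.

(* Since the noise is additive, the stochastic integral of the constant sigma
   is sigma (W t - W s), and dX = X (X - t) dt + sigma dW is an integral
   equation for each driving path w. *)
Definition solves_on {R : realType} (sigma : R) (w : R -> R) (s x t : R)
    (u : R -> R) : Prop :=
  {within `[s, t], continuous u} /\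
  forall r : R, s <= r <= t ->
    u r = x + \int[lebesgue_measure]_(q in `[s, r]) (u q * (u q - q))
            + sigma * (w r - w s).

(* The value at time t of the local solution started from x at time s. By
   uniqueness the set below has at most one element; it is empty once the
   solution has ceased to exist, and the default value 0 used then contributes
   no point to the hitting sets of the levels n >= 1. *)
Definition local_solution {R : realType} (sigma : R) (w : R -> R)
    (s x t : R) : R :=
  xget 0 [set u t | u in [set u | solves_on sigma w s x t u]].

Definition hitting_time {R : realType} (sigma : R) (w : R -> R)
    (s x : R) (n : nat) : \bar R :=
  ereal_inf [set t%:E | t in
    [set t : R | s < t /\ n%:R <= `|local_solution sigma w s x t|]].

Definition blowup_time {R : realType} (sigma : R) (w : R -> R)
    (s x : R) : \bar R :=
  limn (hitting_time sigma w s x).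

Definition blowup_prob {R : realType} {d : measure_display}
    {Omega : measurableType d} (P : probability Omega R)
    (W : R -> Omega -> R) (sigma s x : R) : \bar R :=
  P [set omega | (blowup_time sigma (W ^~ omega) s x < +oo)%E].

Definition blowup_prob_ninfty {R : realType} {d : measure_display}
    {Omega : measurableType d} (P : probability Omega R)
    (W : R -> Omega -> R) (sigma s : R) : \bar R :=
  lim (blowup_prob P W sigma s x @[x --> -oo]).

(* Main.v *)
(* The noise being additive, the SDE is solved path by path: [v = u - sigma W]
   satisfies a Riccati equation with continuous coefficients, linearized by
   [v = p / y] where [(y, p)] solves a linear system globally.  The solution
   explodes iff [y] vanishes.  This makes the explosion event measurable
   ([y] is a limit of Picard iterates, whose integrals are limits of Riemann
   sums) and, by comparison, nondecreasing in the starting point [x].  It then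
   suffices to find an event of positive probability on which the solution
   explodes from every [x].  On [s, s + 1] and [s + 2, s + 3] the path is asked
   to oscillate by at most [M], with [M] so large that this has positive
   probability; the first interval brings the solution down from -oo to a level
   bounded below independently of [x].  Over [s + 1, s + 2] the increment of W is
   asked to exceed a level [L] depending on [M]: as [u (u - t) >= - t ^ 2 / 4],
   the solution is then so large at time [s + 2] that it explodes before
   [s + 3].  The two requirements are independent by a pi-lambda argument. *)

Require Import Defs.
From mathcomp Require Import all_boot all_order all_algebra.
From mathcomp Require Import all_classical all_reals all_analysis.
From mathcomp Require Import measurable_realfun ring lra.

Import Order.TTheory GRing.Theory Num.Theory.
Import numFieldNormedType.Exports.

Local Open Scope classical_set_scope.
Local Open Scope ring_scope.

(** * Primitives of continuous functions *)

Section Calculus.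
Context {R : realType}.
Implicit Types (f F : R -> R) (a b t : R).
Notation mu := (@lebesgue_measure R).

Lemma integrable_continuous f a b :
  continuous f -> mu.-integrable `[a, b] (EFin \o f).
Proof.
move=> cf; apply: continuous_compact_integrable; first exact: segment_compact.
exact: continuous_subspaceT.
Qed.

(** Signed for [t < a], so that [prim f a] has a two-sided derivative at every point, [a]
    included. *)
Definition prim f a t : R :=
  if a <= t then \int[mu]_(q in `[a, t]) f q else - \int[mu]_(q in `[t, a]) f q.

Lemma prim0 f a : prim f a a = 0.
Proof. by rewrite /prim lexx set_itv1 Rintegral_set1. Qed.

Lemma Rintegral_cat f a b t : continuous f -> a <= b -> b <= t ->
  \int[mu]_(q in `[a, t]) f q =
  \int[mu]_(q in `[a, b]) f q + \int[mu]_(q in `[b, t]) f q.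
Proof.
move=> cf ab bt; apply/eqP; rewrite addrC -subr_eq; apply/eqP.
rewrite (@Rintegral_itvB _ f (BLeft a) (BRight t) b)//.
- rewrite Rintegral_itv_obnd_cbnd//.
  apply: (integrableS _ _ _ (integrable_continuous f b t cf)) => //.
  by apply: subset_itvr; rewrite bnd_simp.
- exact: integrable_continuous.
Qed.

Lemma is_derive_prim f a t : continuous f -> is_derive t 1 (prim f a) (f t).
Proof.
(* The fundamental theorem of calculus is applied from a base point strictly below both [a] and [t];
   near [t], [prim f a] is [G - G a]. *)
move=> cf; pose c := Num.min a t - 1.
have ca : c < a by rewrite /c ltrBlDr gt_min ltrDl ltr01.
have ct : c < t by rewrite /c ltrBlDr gt_min ltrDl ltr01 orbT.
pose G r := \int[mu]_(q in `[c, r]) f q.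
have dG : is_derive t 1 G (f t).
  have [||//|//|dG GE] := @continuous_FTC1_closed R f c t (t + 1).
  - by rewrite ltrDl ltr01.
  - exact: integrable_continuous.
  - exact: cf.
  by split; [exact: dG|rewrite -derive1E; exact: GE].
have dGc : is_derive t 1 (G - cst (G a)) (f t).
  by rewrite -[X in is_derive _ _ _ X]subr0; apply: is_deriveB.
apply: near_eq_is_derive dGc.
near=> r.
have cr : c < r by near: r; exact: lt_nbhsr.
rewrite /prim !fctE /G; case: (leP a r) => [ar|/ltW ra].
  rewrite (Rintegral_cat f c a r)//; last exact: ltW.
  by rewrite addrC addrA addNr add0r.
rewrite (Rintegral_cat f c r a)//; last exact: ltW.
by rewrite opprD addrA subrr add0r.
Unshelve. all: by end_near. Qed.

Lemma deriv_continuous F f t : is_derive t 1 F (f t) -> {for t, continuous F}.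
Proof.
by move=> dF; apply/differentiable_continuous/derivable1_diffP; case: dF.
Qed.

Lemma prim_continuous f a : continuous f -> continuous (prim f a).
Proof. by move=> cf t; apply: (deriv_continuous _ f); exact: is_derive_prim. Qed.

Lemma deriv_mvt F f a b : a <= b ->
  (forall t, a <= t <= b -> is_derive t 1 F (f t)) ->
  exists2 c, a <= c <= b & F b - F a = f c * (b - a).
Proof.
move=> ab dF; have [||c cab ->] := @MVT_segment R F f a b ab.
- move=> t; rewrite in_itv/= => /andP[/ltW at_ /ltW tb].
  by apply: dF; rewrite at_ tb.
- apply: derivable_within_continuous => t; rewrite in_itv/= => tab.
  by case: (dF t tab).
by exists c => //; move: cab; rewrite in_itv.
Qed.

Lemma deriv_ge0_le F f a b : a <= b ->
  (forall t, a <= t <= b -> is_derive t 1 F (f t)) ->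
  (forall t, a <= t <= b -> 0 <= f t) -> F a <= F b.
Proof.
move=> ab dF f0; have [c cab] := deriv_mvt F f a b ab dF.
by rewrite -subr_ge0 => ->; rewrite mulr_ge0 ?f0// subr_ge0.
Qed.

Lemma deriv0_eq F f a b : a <= b ->
  (forall t, a <= t <= b -> is_derive t 1 F (f t)) ->
  (forall t, a <= t <= b -> f t = 0) -> F a = F b.
Proof.
move=> ab dF f0; have [c cab] := deriv_mvt F f a b ab dF.
by rewrite f0// mul0r => /eqP; rewrite subr_eq0 => /eqP.
Qed.

Lemma deriv_eq_prim F f a b : continuous f -> a <= b ->
  (forall t, a <= t <= b -> is_derive t 1 F (f t)) ->
  F b = F a + prim f a b.
Proof.
move=> cf ab dF.
have H : (F - prim f a) a = (F - prim f a) b.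
  apply: (@deriv0_eq _ (fun=> 0)) => // t tab.
  rewrite -[X in is_derive _ _ _ X](subrr (f t)).
  by apply: is_deriveB; [exact: dF|exact: is_derive_prim].
by move: H; rewrite !fctE prim0 subr0 => ->; rewrite subrK.
Qed.

Lemma primE f a t : a <= t -> prim f a t = \int[mu]_(q in `[a, t]) f q.
Proof. by rewrite /prim => ->. Qed.

Lemma uniform_continuity_segment f a b (e : R) : continuous f -> 0 < e ->
  exists2 d, 0 < d &
    forall x y, a <= x <= b -> `|y - x| < d -> `|f y - f x| < e.
Proof.
move=> cf e0.
have /compact_near_coveringP nc := @segment_compact R a b.
have : \forall d \near 0^'+, `[a, b]%classic `<=`
    (fun d x => forall y, `|y - x| < d -> `|f y - f x| < e) d.
  apply: nc => x _.
  have /cvgrPdist_lt /(_ (e / 2)) := cf x.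
  rewrite divr_gt0// => /(_ isT) /nbhs_ballP[r /= r0 rf].
  have r2 : 0 < r / 2 by rewrite divr_gt0.
  exists (ball x (r / 2), [set d | d < r / 2]) => /=.
    by split; [exact: nbhsx_ballx|exact: nbhs_right_lt].
  move=> [x' d]/= [xx' dr] y yx'; rewrite -ball_normE/= in xx'.
  have h1 : `|f x - f x'| < e / 2.
    by apply: rf; rewrite -ball_normE/=; apply: (lt_trans xx'); lra.
  have h2 : `|f x - f y| < e / 2.
    apply: rf; rewrite -ball_normE/=.
    have -> : x - y = (x - x') - (y - x') by ring.
    by apply: le_lt_trans (ler_normB _ _) _; lra.
  have -> : f y - f x' = (f x - f x') - (f x - f y) by ring.
  by apply: le_lt_trans (ler_normB _ _) _; lra.
move=> H; near (0 : R)^'+ => d.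
exists d; first by near: d; exact: nbhs_right_gt.
move=> x y xab; have : `[a, b]%classic `<=` (fun d x => forall y, `|y - x| < d -> `|f y - f x| < e) d by near: d.
by move=> /(_ x); apply; rewrite /= in_itv.
Unshelve. all: by end_near. Qed.

End Calculus.

(** * Riemann sums and measurability of parametric integrals *)

Section Riemann_sums.
Context {R : realType}.
Implicit Types (f : R -> R) (a b : R).

(** The primitive telescopes over the grid; the mean value theorem turns each cell into [f] at an
    inner point times [h], and uniform continuity compares it with the left endpoint. *)
Lemma cvg_riemann_sum f a b : continuous f -> a <= b ->
  \sum_(i < N.+1) f (a + i%:R * ((b - a) / N.+1%:R)) * ((b - a) / N.+1%:R)
    @[N --> \oo] --> prim f a b.
Proof.
move=> cf ab; apply/cvgrPdist_le => e e0.
have e'0 : 0 < e / (b - a + 1) by rewrite divr_gt0// ltr_wpDl// subr_ge0.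
have [d d0 fd] := uniform_continuity_segment f a b _ cf e'0.
near=> N.
pose h : R := (b - a) / N.+1%:R.
have h0 : 0 <= h by rewrite divr_ge0// subr_ge0.
have Nh : N.+1%:R * h = b - a by rewrite mulrC divfK.
have hd : h < d.
  rewrite ltr_pdivrMr// mulrC -ltr_pdivrMr//.
  near: N; exists (Num.truncn ((b - a) / d)) => // M/= hM.
  by rewrite -truncn_lt_nat ?divr_ge0 ?subr_ge0// ltW.
have grid (i : nat) : (i <= N.+1)%N -> a <= a + i%:R * h <= b.
  move=> iN; rewrite lerDl mulr_ge0//= -lerBrDl -Nh ler_wpM2r// ler_nat//.
have -> : prim f a b = \sum_(i < N.+1)
    (prim f a (a + i.+1%:R * h) - prim f a (a + i%:R * h)).
  rewrite -(big_mkord xpredT (fun i => prim f a (a + i.+1%:R * h) -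
    prim f a (a + i%:R * h))) telescope_sumr//.
  by rewrite Nh mul0r addr0 prim0 subr0 addrC subrK.
rewrite -sumrB; apply: le_trans (ler_norm_sum _ _ _) _.
apply: (@le_trans _ _ (\sum_(i < N.+1) (e / (b - a + 1) * h))); last first.
  rewrite sumr_const card_ord -mulr_natr -mulrA (mulrC h) Nh.
  rewrite mulrAC ler_pdivrMr ?ltr_wpDl ?subr_ge0//.
  by rewrite ler_pM2l// lerDl.
apply: ler_sum => i _.
have /andP[ai ib] := grid i (ltnW (ltn_ord i)).
have [||c /andP[c1 c2] ->] := @deriv_mvt R (prim f a) f (a + i%:R * h) (a + i.+1%:R * h).
- by rewrite lerD2l ler_wpM2r// ler_nat.
- by move=> t _; exact: is_derive_prim.
have -> : a + i.+1%:R * h - (a + i%:R * h) = h by rewrite -natr1; ring.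
rewrite -mulrBl normrM (ger0_norm h0) ler_wpM2r// ltW// fd//.
  by rewrite ai.
rewrite ger0_norm ?subr_ge0//; apply: le_lt_trans hd.
by rewrite lerBlDl; apply: (le_trans c2); rewrite -[i.+1%:R]natr1 mulrDl mul1r addrA.
Unshelve. all: by end_near. Qed.

(** A pointwise limit of finite Riemann sums, each measurable because every [f r] is. *)
Lemma measurable_prim d (T : measurableType d) (f : R -> T -> R) a b :
  (forall x, continuous (f^~ x)) ->
  (forall r, measurable_fun [set: T] (f r)) ->
  measurable_fun [set: T] (fun x => prim (f^~ x) a b).
Proof.
move=> cf mf.
have main c e : c <= e -> measurable_fun [set: T] (fun x => prim (f^~ x) c e).
  move=> ce; apply: (measurable_fun_cvg (h := fun N x => \sum_(i < N.+1)
    f (c + i%:R * ((e - c) / N.+1%:R)) x * ((e - c) / N.+1%:R))).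
    by move=> N; apply: measurable_sum => i; apply: measurable_funM.
  by move=> x _; exact: cvg_riemann_sum.
have [ab|/ltW ba] := leP a b; first exact: main.
rewrite (_ : (fun x => _) = (fun x => - prim (f^~ x) b a)).
  by apply: measurableT_comp => //; exact: main.
apply/funext => x; have := ba; rewrite le_eqVlt => /predU1P[->|/[dup] ba' /ltW ba''].
  by rewrite prim0 oppr0.
by rewrite /prim leNgt ba' ba''.
Qed.

End Riemann_sums.

(** * A linear Volterra equation *)

Section Volterra.
Context {R : realType}.
Implicit Types (f g z h : R -> R) (s t T K a b c : R).

(** The tail bound depends only on [a], hence is uniform over a family of series with a common
    majorant. *)
Lemma weierstrass_tail (u a : R^nat) : (forall n, `|u n| <= a n) -> cvgn (series a) ->
  cvgn (series u) /\
  forall N, `|limn (series u) - series u N| <= limn (series a) - series a N.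
Proof.
move=> ua ca.
have cu : cvgn (series u).
  apply: normed_cvg; apply: (series_le_cvg _ _ ua ca) => n //=.
  exact: le_trans (ua n).
split=> // N.
have : (fun M => `|series u M - series u N|) @ \oo -->
    `|limn (series u) - series u N|.
  by apply: cvg_norm; apply: cvgB => //; exact: cvg_cst.
move=> /cvg_lim <-//.
apply: limr_le.
  by apply: is_cvg_norm; apply: is_cvgB => //; exact: is_cvg_cst.
near=> M.
have NM : (N <= M)%N by near: M; exact: nbhs_infty_ge.
rewrite sub_series_geq//.
apply: (@le_trans _ _ (series a M - series a N)).
  rewrite sub_series_geq//; apply: le_trans (ler_norm_sum _ _ _) _.
  by apply: ler_sum.
rewrite lerB//; apply: nondecreasing_cvgn_le => //.
apply: nondecreasing_series => n _ _.
exact: le_trans (ua n).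
Unshelve. all: by end_near. Qed.

Lemma continuous_segment_bounded f a b : continuous f ->
  exists2 K, 0 < K & forall t, a <= t <= b -> `|f t| <= K.
Proof.
move=> cf; have [ab|ba] := leP a b; last first.
  by exists 1 => // t /andP[/le_trans /[apply]]; rewrite leNgt ba.
have [|c _ cmax] := @EVT_max R (fun t => `|f t|) a b ab.
  apply: continuous_subspaceT => t; apply: cvg_norm; exact: cf.
exists (`|f c| + 1); first by rewrite ltr_wpDl.
move=> t tab; rewrite ler_wpDr// cmax// in_itv/=.
Qed.

(** [G + prim f s] and [G - prim f s] both have a nonnegative derivative. *)
Lemma prim_le f (G G' : R -> R) s t : continuous f -> s <= t ->
  (forall r, s <= r <= t -> is_derive r 1 G (G' r)) ->
  (forall r, s <= r <= t -> `|f r| <= G' r) ->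
  `|prim f s t| <= G t - G s.
Proof.
move=> cf st dG fG; rewrite ler_norml; apply/andP; split.
  have : (G + prim f s) s <= (G + prim f s) t.
    apply: (@deriv_ge0_le _ _ (fun r => G' r + f r)) => // r rst.
      by apply: is_deriveD; [exact: dG|exact: is_derive_prim].
    by have := fG _ rst; rewrite ler_norml => /andP[+ _]; lra.
  by rewrite !fctE prim0; lra.
have : (G - prim f s) s <= (G - prim f s) t.
  apply: (@deriv_ge0_le _ _ (fun r => G' r - f r)) => // r rst.
    by apply: is_deriveB; [exact: dG|exact: is_derive_prim].
  by have := fG _ rst; rewrite ler_norml => /andP[_ +]; lra.
by rewrite !fctE prim0; lra.
Qed.

Lemma primB f g s t : continuous f -> continuous g -> s <= t ->
  prim (fun r => f r - g r) s t = prim f s t - prim g s t.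
Proof.
move=> cf cg st.
have cfg : continuous (fun r => f r - g r).
  by move=> r; apply: cvgB; [exact: cf|exact: cg].
have dfg r : s <= r <= t -> is_derive r 1 (prim f s - prim g s) (f r - g r).
  by move=> _; apply: is_deriveB; exact: is_derive_prim.
by have := deriv_eq_prim _ _ s t cfg st dfg; rewrite !fctE !prim0 subrr add0r.
Qed.

(** Integral operator with kernel [z r - r - z t]; splitting off the factor [z t] leaves primitives
    of functions free of [t]. *)
Definition volterra z s f t :=
  prim (fun r => (z r - r) * f r) s t - z t * prim f s t.

(** The terms of the Neumann series, not its partial sums. *)
Fixpoint picard z s h n : R -> R :=
  if n is m.+1 then volterra z s (picard z s h m) else h.

(* Frozen before time [s] by [Num.max s t], so as to be continuous on R. *)
Definition volterra_sol z s h t :=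
  limn (series (fun n => picard z s h n (Num.max s t))).

Lemma continuous_drift z : continuous z -> continuous (fun r => z r - r).
Proof. by move=> cz r; apply: cvgB; [exact: cz|exact: cvg_id]. Qed.

Lemma continuousM f g : continuous f -> continuous g ->
  continuous (fun r => f r * g r).
Proof. by move=> cf cg r; apply: cvgM; [exact: cf|exact: cg]. Qed.

Lemma volterra_continuous z s f : continuous z -> continuous f ->
  continuous (volterra z s f).
Proof.
move=> cz cf t; apply: cvgB.
  by apply: prim_continuous; apply: continuousM => //; exact: continuous_drift.
by apply: continuousM => //; exact: prim_continuous.
Qed.

Lemma picard_continuous z s h n : continuous z -> continuous h ->
  continuous (picard z s h n).
Proof.
by move=> cz ch; elim: n => //= n IH; exact: volterra_continuous.
Qed.

Lemma max_continuous s : continuous (fun t => Num.max s t).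
Proof. by move=> t; apply: continuous_max; [exact: cvg_cst|exact: cvg_id]. Qed.

End Volterra.

Section Volterra_solution.
Context {R : realType}.
Implicit Types (f g z h : R -> R) (s t T K a b c : R).

Lemma is_derive_exp_coeff n s t :
  is_derive t 1 (fun r => (r - s) ^+ n.+1 / n.+1`!%:R) ((t - s) ^+ n / n`!%:R).
Proof.
have d1 : is_derive t 1 (fun r => r - s) 1.
  by rewrite -[X in is_derive _ _ _ X]subr0; apply: is_deriveB.
have dX := is_deriveX n.+1 d1.
have dM := is_deriveZ (n.+1`!%:R^-1) dX.
rewrite (_ : (fun r => _) = n.+1`!%:R^-1 \*: (fun r => r - s) ^+ n.+1); last first.
  by apply/funext => r; rewrite /= fctE mulrC.
apply: is_derive_eq dM _; rewrite /= scaler1 factS natrM.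
have -> (p q : R) : p *: q = p * q by [].
by field; rewrite addrC natr1 !pnatr_eq0 -lt0n fact_gt0.
Qed.

Lemma volterraB z f g s t : continuous z -> continuous f -> continuous g ->
  s <= t ->
  volterra z s (fun r => f r - g r) t = volterra z s f t - volterra z s g t.
Proof.
move=> cz cf cg st; rewrite /volterra primB//.
rewrite (_ : (fun r => _) = fun r => (z r - r) * f r - (z r - r) * g r); last first.
  by apply/funext => r; rewrite mulrBr.
rewrite primB//; first ring.
- exact: continuousM _ _ (continuous_drift _ cz) cf.
- exact: continuousM _ _ (continuous_drift _ cz) cg.
Qed.

(** Each iteration integrates once more, which raises the order of [(t - s) ^ n / n!]; [K] adds a
    bound of [z r - r] and one of [z], one for each term of the operator. *)
Lemma picard_bound z s h T : continuous z -> continuous h -> s <= T ->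
  exists C K, forall n t, s <= t <= T ->
    `|picard z s h n t| <= C * (K ^+ n * ((t - s) ^+ n / n`!%:R)).
Proof.
move=> cz ch sT.
have [C C0 hC] := continuous_segment_bounded _ s T ch.
have [K1 K10 hK1] := continuous_segment_bounded _ s T (continuous_drift _ cz).
have [K2 K20 hK2] := continuous_segment_bounded _ s T cz.
pose K := K1 + K2; have K0 : 0 < K by rewrite addr_gt0.
exists C, K; elim=> [|n IH] t /andP[st tT].
  by rewrite !expr0 mul1r fact0 divr1 mulr1 hC// st.
pose G c r := c * (C * K ^+ n) * ((r - s) ^+ n.+1 / n.+1`!%:R).
pose G' c r := c * (C * K ^+ n) * ((r - s) ^+ n / n`!%:R).
have dG c r : s <= r <= t -> is_derive r 1 (G c) (G' c r).
  by move=> _; apply: is_deriveZ; exact: is_derive_exp_coeff.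
have Gs c : G c s = 0 by rewrite /G subrr expr0n/= mul0r mulr0.
have cp := picard_continuous _ s _ n cz ch.
have cdp := continuousM _ _ (continuous_drift _ cz) cp.
have H1 : `|prim (fun r => (z r - r) * picard z s h n r) s t| <= G K1 t.
  rewrite -[leRHS]subr0 -(Gs K1); apply: prim_le cdp st (dG _) _ => r /andP[sr rt].
  have rT := le_trans rt tT.
  rewrite normrM /G' -mulrA ler_pM ?hK1 ?sr// -mulrA IH// sr.
  exact: rT.
have H2 : `|prim (picard z s h n) s t| <= G 1 t.
  rewrite -[leRHS]subr0 -(Gs 1); apply: prim_le cp st (dG _) _ => r /andP[sr rt].
  by rewrite /G' mul1r -mulrA IH// sr (le_trans rt).
rewrite /= /volterra; apply: le_trans (ler_normB _ _) _.
rewrite (_ : C * _ = G K1 t + K2 * G 1 t); last first.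
  by rewrite /G /K exprS; ring.
by rewrite lerD// normrM ler_pM// hK2// st.
Qed.

(** The factorial bound makes the Neumann series converge uniformly on bounded intervals; continuity
    and the fixed point equation pass to the limit from the partial sums [S N]. *)
Lemma volterra_solP z s h : continuous z -> continuous h ->
  [/\ continuous (volterra_sol z s h),
      forall t, s <= t -> (fun N => \sum_(0 <= i < N) picard z s h i t) @ \oo
        --> volterra_sol z s h t &
      forall t, s <= t ->
        volterra_sol z s h t = h t + volterra z s (volterra_sol z s h) t].
Proof.
move=> cz ch.
pose S N t := \sum_(0 <= i < N) picard z s h i t.
pose g := volterra_sol z s h.
have cS N : continuous (S N).
  elim: N => [|N IH].
    rewrite (_ : S 0%N = fun=> 0); first by move=> t; exact: cvg_cst.
    by apply/funext => t; rewrite /S big_nil.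
  rewrite (_ : S N.+1 = (fun t => S N t + picard z s h N t)).
    move=> t; apply: cvgD; [exact: IH|exact: picard_continuous].
  by apply/funext => t; rewrite /S big_nat_recr.
(* The error [e N] is a tail of an exponential series and does not depend on [t]. *)
have unif T : s <= T -> exists e : R^nat, e @ \oo --> 0 /\
    forall t, t <= T -> cvgn (fun N => S N (Num.max s t)) /\
    forall N, `|g t - S N (Num.max s t)| <= e N.
  move=> sT; have [C [K CK]] := picard_bound z s h T cz ch sT.
  pose a n := `|C| * exp_coeff (`|K| * (T - s)) n.
  have ca : cvgn (series a).
    by apply: is_cvg_seriesZ; exact: is_cvg_series_exp_coeff.
  exists (fun N => limn (series a) - series a N); split.
    rewrite -(subrr (limn (series a))); apply: cvgB => //; exact: cvg_cst.
  move=> t tT; apply: weierstrass_tail ca => n.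
  have sm : s <= Num.max s t by rewrite le_max lexx.
  have mT : Num.max s t <= T by rewrite ge_max sT.
  apply: le_trans (CK n _ _) _; first by rewrite sm.
  apply: le_trans (ler_norm _) _.
  rewrite normrM /a ler_wpM2l// normrM normrX /exp_coeff/= exprMn -mulrA.
  rewrite ler_wpM2l ?exprn_ge0// normrM normrX normfV normr_nat.
  by rewrite ler_wpM2r// lerXn2r// ?nnegrE ?subr_ge0// ger0_norm ?subr_ge0// lerD2r.
(* A uniform limit of continuous functions; the horizon [Num.max s t + 1] covers a neighbourhood of
   [t]. *)
have cg : continuous g.
  move=> t; apply/cvgrPdist_lt => e e0.
  have sT : s <= Num.max s t + 1 by rewrite ler_wpDr// le_max lexx.
  have [a [a0 ha]] := unif _ sT.
  have e3 : 0 < e / 3 by rewrite divr_gt0.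
  have [N _ /(_ N (leqnn N)) aN] := ((cvgrPdist_lt _ _).1 a0) _ e3.
  rewrite /= sub0r normrN in aN.
  have cSt : {for t, continuous (fun t => S N (Num.max s t))}.
    by apply: continuous_comp; [exact: max_continuous|exact: cS].
  have tT : t <= Num.max s t + 1 by rewrite ler_wpDr// le_max lexx orbT.
  near=> r.
  have rT : r <= Num.max s t + 1.
    apply: ltW; near: r; apply: lt_nbhsl; by rewrite ltr_pwDr// le_max lexx orbT.
  have h1 : `|g t - S N (Num.max s t)| < e / 3.
    by apply: le_lt_trans ((ha _ tT).2 N) _; rewrite (le_lt_trans (ler_norm _)).
  have h2 : `|g r - S N (Num.max s r)| < e / 3.
    by apply: le_lt_trans ((ha _ rT).2 N) _; rewrite (le_lt_trans (ler_norm _)).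
  have h3 : `|S N (Num.max s t) - S N (Num.max s r)| < e / 3.
    by near: r; exact: ((cvgrPdist_lt _ _).1 cSt).
  have -> : g t - g r = (g t - S N (Num.max s t)) +
    (S N (Num.max s t) - S N (Num.max s r)) - (g r - S N (Num.max s r)) by ring.
  apply: le_lt_trans (ler_normB _ _) _.
  have := ler_normD (g t - S N (Num.max s t)) (S N (Num.max s t) - S N (Num.max s r)).
  by lra.
have Sg t : s <= t -> (fun N => S N t) @ \oo --> g t.
  move=> st; have [a [a0 ha]] := unif _ st.
  have [cN _] := ha _ (lexx t); rewrite /g /volterra_sol.
  by move: cN; rewrite max_r.
split=> // t st.
have SE N : S N.+1 t = h t + volterra z s (S N) t.
  elim: N => [|N IH].
    rewrite /S big_nat1 /volterra.
    have p0 f : (forall r, f r = 0) -> prim f s t = 0.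
      by move=> f0; rewrite primE// /Rintegral (eq_integral (cst 0%E)) ?integral0// => r _; rewrite f0.
    by rewrite !p0 ?mulr0 ?subrr ?addr0// => r; rewrite big_nil ?mulr0.
  rewrite [LHS]/S big_nat_recr//= -/(S N.+1 t) IH -addrA; congr (_ + _).
  have -> : picard z s h N = fun r => S N.+1 r - S N r.
    by apply/funext => r; rewrite /S (big_nat_recr N)//= addrAC subrr add0r.
  by rewrite volterraB// addrC subrK.
have [K2 K20 hK2] := continuous_segment_bounded _ s t cz.
have [K1 K10 hK1] := continuous_segment_bounded _ s t (continuous_drift _ cz).
have [a [a0 ha]] := unif _ st.
(* The operator is linear and [g - S N] is at most [e / c] on [[s, t]]; the [+ 1] in [c] keeps it
   positive when [t = s]. *)
have vg : (fun N => volterra z s (S N) t) @ \oo --> volterra z s g t.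
  apply/cvgrPdist_le => e e0.
  pose c := (K1 + K2) * (t - s) + 1.
  have c0 : 0 < c by rewrite ltr_wpDl// mulr_ge0 ?subr_ge0// addr_ge0// ltW.
  have ec0 : 0 < e / c by rewrite divr_gt0.
  have [N0 _ aN0] := ((cvgrPdist_lt _ _).1 a0) _ ec0.
  exists N0 => // N /= N0N; have := aN0 N N0N; rewrite /= sub0r normrN => aN.
  have aN' := le_lt_trans (ler_norm _) aN.
  rewrite -volterraB//.
  have cgS : continuous (fun r => g r - S N r).
    by move=> r; apply: cvgB; [exact: cg|exact: cS].
  have gSb r : s <= r <= t -> `|g r - S N r| <= e / c.
    move=> /andP[sr rt]; have [_ /(_ N)] := ha r rt.
    by rewrite max_r// => /le_trans; apply; exact: ltW.
  have dl k (r : R) : s <= r <= t -> is_derive r 1 (fun r => k * r) k.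
    by move=> _; rewrite -[X in is_derive _ _ _ X]mulr1; apply: is_deriveZ.
  have cdp := continuousM _ _ (continuous_drift _ cz) cgS.
  have B1 : `|prim (fun r => (z r - r) * (g r - S N r)) s t| <=
      K1 * (e / c) * t - K1 * (e / c) * s.
    apply: prim_le cdp st (dl _) _ => r rst.
    by rewrite normrM ler_pM// ?hK1// gSb.
  have B2 : `|prim (fun r => g r - S N r) s t| <= (e / c) * t - (e / c) * s.
    exact: prim_le cgS st (dl _) gSb.
  rewrite /volterra; apply: le_trans (ler_normB _ _) _.
  apply: (@le_trans _ _ (K1 * (e / c) * t - K1 * (e / c) * s +
    K2 * (e / c * t - e / c * s))).
    by rewrite lerD// normrM ler_pM// hK2// st lexx.
  rewrite (_ : _ + K2 * _ = e / c * ((K1 + K2) * (t - s))); last by ring.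
  by rewrite mulrAC ler_pdivrMr// ler_pM2l// /c lerDl.
have hvg : (fun N => S N.+1 t) @ \oo --> h t + volterra z s g t.
  by under eq_fun do rewrite SE; apply: cvgD => //; exact: cvg_cst.
have := Sg t st; rewrite -(@cvg_shiftS _ (fun N => S N t)) => Sg1.
exact: (cvg_unique _ Sg1 hvg).
Unshelve. all: by end_near. Qed.

End Volterra_solution.

(** * Linearization of the Riccati equation *)

Section Riccati.
Context {R : realType}.
Implicit Types (f g z u F G : R -> R) (s t r x c : R).

Lemma is_derive_mul F G (f g : R) t : is_derive t 1 F f -> is_derive t 1 G g ->
  is_derive t 1 (fun r => F r * G r) (f * G t + F t * g).
Proof.
move=> dF dG; have dM := is_deriveM dF dG.
apply: is_derive_eq dM _; rewrite addrC mulrC.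
by rewrite -[_ *: _]/(_ * _) -[_ *: _]/(_ * _) (mulrC (G t)).
Qed.

Lemma is_derive_exp F (f : R) t : is_derive t 1 F f ->
  is_derive t 1 (fun r => expR (F r)) (f * expR (F t)).
Proof.
move=> dF; have dE := @is_derive1_comp _ _ _ _ _ _ (is_derive_expR (F t)) dF.
by apply: is_derive_eq dE _; rewrite mulrC.
Qed.

(** Continuity is asked on the whole line so that the calculus of [prim] applies; the equation
    itself concerns only [[s, t]]. *)
Definition noisy_sol z s x t u : Prop := continuous u /\
  forall r, s <= r <= t -> u r = x + prim (fun q => u q * (u q - q)) s r + z r.

(* Writing [v = u - z] and [u = g / y] linearizes the Riccati equation
   [v' = u (u - t)] into [y' = - g], [p' = (z - t) g], where [p = v y] and
   [g = p + z y], with [y s = 1] and [p s = x].  Eliminating [y] and [p] leaves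
   a Volterra equation for [g]; the solution [u] exists as long as [y > 0]. *)
Definition lin_g z s x := volterra_sol z s (fun t => x + z t).
Definition lin_p z s x t := x + prim (fun r => (z r - r) * lin_g z s x r) s t.
Definition lin_y z s x t := 1 - prim (lin_g z s x) s t.

Variables (z : R -> R) (s : R).
Hypothesis cz : continuous z.

Let ch x : continuous (fun t => x + z t).
Proof. by move=> t; apply: cvgD; [exact: cvg_cst|exact: cz]. Qed.

Lemma lin_g_continuous x : continuous (lin_g z s x).
Proof. by have [] := volterra_solP z s _ cz (ch x). Qed.

Lemma lin_gE x t : s <= t -> lin_g z s x t = lin_p z s x t + z t * lin_y z s x t.
Proof.
move=> st; have [_ _ /(_ t st) E] := volterra_solP z s _ cz (ch x).
by rewrite /lin_g E /volterra /lin_p /lin_y /lin_g; ring.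
Qed.

Lemma is_derive_lin_y x t : is_derive t 1 (lin_y z s x) (- lin_g z s x t).
Proof.
rewrite -[X in is_derive _ _ _ X]add0r; apply: is_deriveB.
by apply: is_derive_prim; exact: lin_g_continuous.
Qed.

Lemma is_derive_lin_p x t :
  is_derive t 1 (lin_p z s x) ((z t - t) * lin_g z s x t).
Proof.
rewrite -[X in is_derive _ _ _ X]add0r; apply: is_deriveD.
apply: (is_derive_prim (fun r => (z r - r) * lin_g z s x r)).
by apply: continuousM; [exact: continuous_drift|exact: lin_g_continuous].
Qed.

Lemma lin_ys x : lin_y z s x s = 1.
Proof. by rewrite /lin_y prim0 subr0. Qed.

Lemma lin_y_continuous x : continuous (lin_y z s x).
Proof. move=> t; exact: (deriv_continuous _ (fun t => - lin_g z s x t)  _ (is_derive_lin_y x t)). Qed.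

Let drift_continuous u : continuous u -> continuous (fun q => u q * (u q - q)).
Proof. by move=> cu; apply: continuousM => //; exact: continuous_drift. Qed.

(* [D = p - v y], with [v = u - z], satisfies the linear equation
   [D' = (u - t) D], hence keeps the sign of [D s = x - x']. *)
Lemma lin_defect x x' t u : noisy_sol z s x' t u -> forall r, s <= r <= t ->
  exists2 k, 0 < k & lin_g z s x r - u r * lin_y z s x r = (x - x') * k.
Proof.
move=> [cu uE] r0 /andP[sr0 r0t].
pose V r := x' + prim (fun q => u q * (u q - q)) s r.
have dV r : is_derive r 1 V (u r * (u r - r)).
  rewrite -[X in is_derive _ _ _ X]add0r; apply: is_deriveD.
  by apply: (is_derive_prim (fun r => u r * (u r - r))); exact: drift_continuous.
have cd := continuous_drift _ cu.
pose D r := lin_p z s x r - V r * lin_y z s x r.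
pose E r := expR (- prim (fun q => u q - q) s r).
have dD r : is_derive r 1 D ((z r - r) * lin_g z s x r -
    (u r * (u r - r) * lin_y z s x r + V r * - lin_g z s x r)).
  apply: is_deriveB; first exact: is_derive_lin_p.
  by apply: is_derive_mul; exact: is_derive_lin_y.
have dE r : is_derive r 1 E (- (u r - r) * E r).
  by apply: is_derive_exp; apply: is_deriveN; exact: (is_derive_prim (fun q => u q - q)).
have gD r : s <= r <= t -> lin_g z s x r = D r + u r * lin_y z s x r.
  move=> rst; have /andP[sr _] := rst.
  by rewrite lin_gE// /D uE// -/(V r); ring.
have DE : D s * E s = D r0 * E r0.
  pose DE' r := ((z r - r) * lin_g z s x r -
    (u r * (u r - r) * lin_y z s x r + V r * - lin_g z s x r)) * E r +
    D r * (- (u r - r) * E r).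
  apply: (@deriv0_eq _ (fun r => D r * E r) DE' s r0 sr0).
    by move=> r _; exact: is_derive_mul.
  move=> r /andP[sr rr0]; have rst : s <= r <= t by rewrite sr (le_trans rr0).
  have VE : V r = u r - z r by rewrite uE// -/(V r) addrK.
  by rewrite /DE' gD// VE; ring.
have Ds : D s = x - x'.
  by rewrite /D /lin_p /V lin_ys !prim0 !addr0 mulr1.
have Es : E s = 1 by rewrite /E prim0 oppr0 expR0.
have DxE : x - x' = D r0 * E r0 by rewrite -DE Es mulr1.
have E0 : 0 < E r0 by exact: expR_gt0.
have {}gD := gD r0 (introT andP (conj sr0 r0t)).
exists (E r0)^-1; first by rewrite invr_gt0.
rewrite DxE {}gD addrK; move: (D r0) (E r0) E0 => Dr Er E0.
exact: esym (mulfK (lt0r_neq0 E0) Dr).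
Qed.

(** By the sign of the defect, [y' = - g >= - u y], so [y] times the exponential of the integral of
    [u] is nondecreasing from [1]. The case [x' = x] says that a solution forces [y > 0]; the case
    [x < x'] compares starting points. *)
Lemma lin_y_gt0 x x' t u : x <= x' -> noisy_sol z s x' t u ->
  forall r, s <= r <= t -> 0 < lin_y z s x r.
Proof.
move=> xx' hu r0 /andP[sr0 r0t]; have [cu _] := hu.
pose E r := expR (prim u s r).
have dE r : is_derive r 1 E (u r * E r).
  by apply: is_derive_exp; exact: is_derive_prim.
have : lin_y z s x s * E s <= lin_y z s x r0 * E r0.
  apply: (@deriv_ge0_le _ (fun r => lin_y z s x r * E r)
    (fun r => - lin_g z s x r * E r + lin_y z s x r * (u r * E r)) s r0 sr0).
    by move=> r _; apply: is_derive_mul; exact: is_derive_lin_y.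
  move=> r /andP[sr rr0].
  have rst : s <= r <= t by rewrite sr (le_trans rr0).
  have [k k0 kE] := lin_defect x x' t u hu r rst.
  rewrite (_ : _ + _ = - (lin_g z s x r - u r * lin_y z s x r) * E r); last by ring.
  rewrite kE -mulNr opprB; apply: mulr_ge0; last exact: expR_ge0.
  by rewrite mulr_ge0 ?subr_ge0// ltW.
rewrite lin_ys {1}/E prim0 expR0 mulr1 => h.
by rewrite -(pmulr_lgt0 _ (expR_gt0 (prim u s r0))); exact: lt_le_trans h.
Qed.

(** The defect is zero for equal starting points. Where [y] is positive the value of a solution is
    thus forced, which is uniqueness. *)
Lemma noisy_solE x t u : noisy_sol z s x t u -> forall r, s <= r <= t ->
  lin_g z s x r = u r * lin_y z s x r.
Proof.
move=> hu r rst; have [k _] := lin_defect x x t u hu r rst.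
by rewrite subrr mul0r => /eqP; rewrite subr_eq0 => /eqP.
Qed.

(** Composing with [clamp] extends a function by constants, turning continuity on a segment into
    continuity on the line. *)
Definition clamp s t r : R := Num.max s (Num.min r t).

Lemma clamp_continuous a b : continuous (clamp a b).
Proof.
move=> r; apply: (@continuous_max _ _ (fun=> a) (fun r => Num.min r b)).
  exact: cvg_cst.
by apply: continuous_min; [exact: cvg_id|exact: cvg_cst].
Qed.

Lemma clamp_itv a b r : a <= b -> a <= clamp a b r <= b.
Proof. by move=> ab; rewrite /clamp le_max lexx/= ge_max ab ge_min lexx orbT. Qed.

Lemma clampE a b r : a <= r <= b -> clamp a b r = r.
Proof. by move=> /andP[ar rb]; rewrite /clamp min_l// max_r. Qed.

Definition lin_u x t r :=
  lin_g z s x (clamp s t r) / lin_y z s x (clamp s t r).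

(** For [v = p / y], the quotient rule gives [v' = g (g - r y) / y ^ 2], which is [u (u - r)] with
    [u = g / y]. *)
Lemma noisy_sol_lin x t : s <= t -> (forall r, s <= r <= t -> 0 < lin_y z s x r) ->
  noisy_sol z s x t (lin_u x t).
Proof.
move=> st y0.
have y0' r : lin_y z s x (clamp s t r) != 0 by rewrite gt_eqF// y0 ?clamp_itv.
have cu : continuous (lin_u x t).
  move=> r; apply: cvgM.
    by apply: continuous_comp; [exact: clamp_continuous|exact: lin_g_continuous].
  apply: cvgV; first exact: y0'.
  by apply: continuous_comp; [exact: clamp_continuous|exact: lin_y_continuous].
split => // r0 /andP[sr0 r0t].
pose U := lin_u x t.
pose v r := lin_p z s x r * (lin_y z s x r)^-1.
have dv r : s <= r <= r0 -> is_derive r 1 v (U r * (U r - r)).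
  move=> /andP[sr rr0]; have rst : s <= r <= t by rewrite sr (le_trans rr0).
  have yr : lin_y z s x r != 0 by rewrite gt_eqF ?y0.
  have dyV := is_deriveV yr (is_derive_lin_y x r).
  have dM := is_derive_mul _ _ _ _ r (is_derive_lin_p x r) dyV.
  apply: is_derive_eq dM _.
  rewrite /U /lin_u clampE// -[_ *: _]/(_ * _) lin_gE//.
  by field.
have := deriv_eq_prim v (fun r => U r * (U r - r)) s r0 (drift_continuous _ cu) sr0 dv.
have -> : v s = x by rewrite /v lin_ys invr1 mulr1 /lin_p prim0 addr0.
move=> <-; have r0st : s <= r0 <= t by rewrite sr0.
have yr : lin_y z s x r0 != 0 by rewrite gt_eqF ?y0.
by rewrite /lin_u clampE// lin_gE// /v; field.
Qed.

End Riccati.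

(** * Explosion of the pathwise solution *)

Section Explosion.
Context {R : realType}.
Implicit Types (f u : R -> R) (t r x c : R).

Lemma continuous_comp_within (A : set R) f (c : R -> R) :
  {within A, continuous f} -> continuous c -> (forall r, A (c r)) ->
  continuous (fun r => f (c r)).
Proof.
move=> /subspace_continuousP cf cc Ac r.
apply: (cvg_trans _ (cf _ (Ac r))) => P PA.
have PA' : \forall q \near c r, A q -> P (f q) by exact: PA.
have cP := cc r _ PA'.
have cP' : \forall q \near r, A (c q) -> P (f (c q)) by exact: cP.
suff : \forall q \near r, P (f (c q)) by [].
by apply: filterS cP' => q; apply; exact: Ac.
Qed.

Variables (sigma : R) (w : R -> R) (s : R).
Hypotheses (s0 : 0 <= s) (cw : {within `[0, +oo[, continuous w}).

(** Freezing the path before [s] makes it continuous on the whole line. *)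
Definition noise r := sigma * (w (Num.max s r) - w s).

Lemma noise_continuous : continuous noise.
Proof.
move=> r; apply: cvgM; first exact: cvg_cst.
apply: cvgB; last exact: cvg_cst.
apply: (continuous_comp_within _ w (fun r => Num.max s r) cw).
  exact: max_continuous.
by move=> q; rewrite /= in_itv/= andbT le_max s0.
Qed.

Lemma noiseE r : s <= r -> noise r = sigma * (w r - w s).
Proof. by move=> sr; rewrite /noise max_r. Qed.

Let g := lin_g noise s.
Let y := lin_y noise s.

Lemma noisy_sol_of_solves_on x t u : s <= t -> solves_on sigma w s x t u ->
  noisy_sol noise s x t (fun r => u (clamp s t r)).
Proof.
move=> st [cu uE]; split.
  apply: (continuous_comp_within _ u (clamp s t) cu); first exact: clamp_continuous.
  by move=> r; rewrite /= in_itv/= clamp_itv.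
move=> r /andP[sr rt]; rewrite clampE ?sr// uE ?sr// noiseE// primE//.
congr (_ + _ + _); apply: eq_Rintegral => q.
by rewrite inE/= in_itv/= => /andP[sq qr]; rewrite clampE// sq (le_trans qr).
Qed.

Lemma solves_on_of_noisy_sol x t u :
  noisy_sol noise s x t u -> solves_on sigma w s x t u.
Proof.
move=> [cu uE]; split; first exact: continuous_subspaceT.
by move=> r /andP[sr rt]; rewrite uE ?sr// noiseE// primE.
Qed.

Lemma solves_onP x t : s <= t ->
  (exists u, solves_on sigma w s x t u) <-> forall r, s <= r <= t -> 0 < y x r.
Proof.
move=> st; split=> [[u /(noisy_sol_of_solves_on _ _ _ st) hu] r|y0].
  exact: (lin_y_gt0 _ _ noise_continuous x x t _ (lexx x) hu).
exists (lin_u noise s x t); apply: solves_on_of_noisy_sol.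
exact: noisy_sol_lin noise_continuous _ _ st y0.
Qed.

Lemma local_solutionE x t : s <= t ->
  (forall r, s <= r <= t -> 0 < y x r) ->
  local_solution sigma w s x t = g x t / y x t.
Proof.
move=> st y0; have tst : s <= t <= t by rewrite st lexx.
have val u : solves_on sigma w s x t u -> u t = g x t / y x t.
  move=> /(noisy_sol_of_solves_on _ _ _ st) hu.
  have := noisy_solE _ _ noise_continuous x t _ hu t tst.
  by rewrite clampE// -/(g x t) -/(y x t) => ->; rewrite mulfK// gt_eqF// y0.
have [u hu] := (solves_onP x t st).2 y0.
apply: xget_subset1; first by exists u => //; exact: val.
by move=> _ _ [u1 /val -> <-] [u2 /val -> <-].
Qed.

Lemma hitting_time_nondecreasing x : nondecreasing_seq (hitting_time sigma w s x).
Proof.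
move=> m n mn; apply: ereal_inf_le_tmp => _ [t [st nt] <-]; exists t => //.
by split=> //; apply: le_trans nt; rewrite ler_nat.
Qed.

(** Take the infimum of the times where [y <= 0]: continuity excludes [y > 0] there, the limit from
    the left excludes [y < 0], and [y s = 1] separates it from [s]. *)
Lemma first_zero x t : s <= t -> y x t <= 0 ->
  exists2 tau, s < tau & y x tau = 0 /\ forall r, s <= r < tau -> 0 < y x r.
Proof.
move=> st yt.
have cy := lin_y_continuous _ s noise_continuous x.
pose Z : set R := [set r | s <= r /\ y x r <= 0].
pose tau := inf Z.
have hZ : has_inf Z by split; [exists t|exists s => r []].
have stau : s <= tau by apply: lb_le_inf => [|r []//]; exists t.
have pos r : s <= r < tau -> 0 < y x r.
  move=> /andP[sr rtau]; rewrite ltNge; apply/negP => yr.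
  have : tau <= r by apply: ge_inf; [exact: hZ.2|].
  by rewrite leNgt rtau.
have ytau : y x tau <= 0.
  rewrite leNgt; apply/negP => ytau.
  have : \forall r \near tau, 0 < y x r by exact: (cvgr_gt (y x tau) (cy tau)).
  move=> /nbhs_ballP[e /= e0 he].
  have [r [sr yr] rtau] := inf_adherent e0 hZ.
  have taur : tau <= r by apply: ge_inf; [exact: hZ.2|].
  have := he r; rewrite /ball/= distrC ger0_norm ?subr_ge0// ltrBlDl => /(_ rtau).
  by rewrite ltNge yr.
have stau' : s < tau.
  rewrite lt_neqAle stau andbT; apply/eqP => stauE.
  by move: ytau; rewrite -stauE /y lin_ys ler10.
exists tau => //; split=> //; apply/eqP; rewrite eq_le ytau/=.
have cl : y x r @[r --> tau^'-] --> y x tau.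
  exact: cvg_at_left_filter (cy tau).
rewrite -(cvg_lim _ cl)//; apply: limr_ge; first by apply/cvg_ex; exists (y x tau).
near=> r; apply: ltW; apply: pos; apply/andP; split; last first.
  by near: r; exact: nbhs_left_lt.
by near: r; exact: nbhs_left_ge.
Unshelve. all: by end_near. Qed.

(** While [y > 0] the solution is [g / y]. If [y] stays positive, it is bounded on each [[s, T]] and
    the hitting times tend to infinity; otherwise every level is reached by the first zero of
    [y]. *)
Lemma explosionP x : (blowup_time sigma w s x < +oo)%E <->
  exists2 t, s <= t & y x t <= 0.
Proof.
have cvgH : cvgn (hitting_time sigma w s x).
  exact: ereal_nondecreasing_is_cvgn (hitting_time_nondecreasing x).
have cy := lin_y_continuous _ s noise_continuous x.
split=> [|[t st yt]].
  apply: contraPP => noz; apply/negP; rewrite -leNgt leye_eq; apply/eqP.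
  have pos t : s <= t -> 0 < y x t.
    by move=> st; rewrite ltNge; apply/negP => yt; apply: noz; exists t.
  rewrite /blowup_time; apply: cvg_lim => //; apply/cvgeyPge => A.
  pose T := Num.max s A.
  have sT : s <= T by rewrite /T le_max lexx.
  have posT r : s <= r <= T -> 0 < y x r by move=> /andP[sr _]; exact: pos.
  have hs := noisy_sol_lin _ _ noise_continuous x T sT posT.
  have [K K0 hK] := continuous_segment_bounded _ s T hs.1.
  (* Once [n] exceeds the bound [K] on [[s, T]], level [n] cannot be hit before [A]. *)
  near=> n; apply: le_ereal_inf_tmp => _ [r [sr nr] <-]; rewrite lee_fin.
  rewrite leNgt; apply/negP => rA.
  have rT : r <= T by rewrite /T le_max (ltW rA) orbT.
  have : `|local_solution sigma w s x r| <= K.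
    rewrite local_solutionE; last 2 first.
    - exact: ltW.
    - by move=> q /andP[sq _]; exact: pos.
    by have := hK r; rewrite /lin_u clampE ?(ltW sr)//; exact.
  move=> /(le_trans nr); apply/negP; rewrite -ltNge.
  by near: n; exact: nbhs_infty_gtr.
have [tau stau [ytau pos]] := first_zero x t st yt.
suff H n : (hitting_time sigma w s x n <= tau%:E)%E.
  apply: (@le_lt_trans _ _ tau%:E); last exact: ltry.
  by apply: lime_le => //; exact: nearW.
apply: contrapT => /negP; rewrite -ltNge => tauH.
(* If level [n] is not reached by [tau], then [y' = - g >= - n y] before [tau]: [y] decays at most
   exponentially and cannot vanish at [tau]. *)
have small r : s < r < tau -> `|g x r| <= n%:R * y x r.
  move=> /andP[sr rtau]; rewrite leNgt; apply/negP => gr.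
  have posr q : s <= q <= r -> 0 < y x q.
    by move=> /andP[sq qr]; apply: pos; rewrite sq (le_lt_trans qr).
  have yr : 0 < y x r by apply: pos; rewrite (ltW sr).
  have : (hitting_time sigma w s x n <= r%:E)%E.
    apply: ereal_inf_lbound; exists r => //; split=> //.
    rewrite local_solutionE ?(ltW sr)// normrM normfV (gtr0_norm yr).
    by rewrite ler_pdivlMr// ltW.
  move=> /(lt_le_trans tauH); rewrite lte_fin ltNge; apply/negP/negPn; exact: ltW.
pose E r := expR (n%:R * r).
pose F r := y x r * E r.
have dE r : is_derive r 1 E (n%:R * E r).
  apply: is_derive_exp; rewrite -[X in is_derive _ _ _ X]mulr1.
  exact: is_deriveZ.
have dF r : is_derive r 1 F (- g x r * E r + y x r * (n%:R * E r)).
  by apply: is_derive_mul; exact: is_derive_lin_y noise_continuous _ _.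
have cF : continuous F.
  by move=> r; exact: (deriv_continuous F (fun r => - g x r * E r + y x r * (n%:R * E r)) r (dF r)).
(* Hitting times only see times after [s], so monotonicity of [F] is started strictly inside []s,
   tau[]. *)
pose m := (s + tau) / 2.
have sm : s < m by rewrite /m; lra.
have mtau : m < tau by rewrite /m; lra.
have Fm : 0 < F m by rewrite mulr_gt0 ?expR_gt0// pos// mtau ltW.
have Fmono r : m <= r < tau -> F m <= F r.
  move=> /andP[mr rtau].
  apply: (deriv_ge0_le F _ m r mr (fun r _ => dF r)) => q /andP[mq qr].
  rewrite (_ : _ + _ = (n%:R * y x q - g x q) * E q); last by ring.
  apply: mulr_ge0; last exact: expR_ge0.
  rewrite subr_ge0; apply: le_trans (ler_norm _) _; apply: small.
  by rewrite (lt_le_trans sm)// (le_lt_trans qr).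
have cl : F r @[r --> tau^'-] --> F tau by exact: cvg_at_left_filter (cF tau).
have : F m <= F tau.
  rewrite -(cvg_lim _ cl)//; apply: limr_ge; first by apply/cvg_ex; exists (F tau).
  near=> r; apply: Fmono; apply/andP; split; last first.
    by near: r; exact: nbhs_left_lt.
  by near: r; exact: nbhs_left_ge.
by rewrite {2}/F ytau mul0r leNgt Fm.
Unshelve. all: by end_near. Qed.

(** Without explosion from [x'], a solution from [x'] exists up to [t], and comparison makes [y x t]
    positive. *)
Lemma explosion_nondecreasing x x' : x <= x' ->
  (blowup_time sigma w s x < +oo)%E -> (blowup_time sigma w s x' < +oo)%E.
Proof.
move=> xx' /explosionP[t st yt]; apply/explosionP; apply: contrapT => noz.
have y0 r : s <= r <= t -> 0 < y x' r.
  by move=> /andP[sr _]; rewrite ltNge; apply/negP => yr; apply: noz; exists r.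
have hs := noisy_sol_lin _ _ noise_continuous x' t st y0.
have := lin_y_gt0 _ _ noise_continuous x x' t _ xx' hs t.
by rewrite st lexx => /(_ isT); rewrite ltNge -/(y x t) yt.
Qed.

End Explosion.

(** * Path conditions that force explosion *)

Section Forced_explosion.
Context {R : realType}.
Implicit Types (F f u w : R -> R) (a s t r x : R).

(* [(- 1 / F)' >= 1 / 8] on an interval of length [1]. *)
Lemma quadratic_growth F f a :
  (forall r, a <= r <= a + 1 -> is_derive r 1 F (f r)) ->
  (forall r, a <= r <= a + 1 -> F r ^+ 2 / 8 <= f r) ->
  (forall r, a <= r <= a + 1 -> 9 <= F r) \/
  (forall r, a <= r <= a + 1 -> F r <= - 9) -> False.
Proof.
move=> dF hf hF.
have a1 : a <= a + 1 by rewrite lerDl.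
have aa1 : a <= a <= a + 1 by rewrite lexx.
have aa2 : a <= a + 1 <= a + 1 by rewrite a1 lexx.
have F0 r : a <= r <= a + 1 -> F r != 0.
  by case: hF => h /h; [move=> ?; rewrite gt_eqF//; lra|move=> ?; rewrite lt_eqF//; lra].
have dV r : a <= r <= a + 1 -> is_derive r 1 (fun r => (F r)^-1) (- (F r) ^- 2 *: f r).
  by move=> ar; apply: is_deriveV; [exact: F0|exact: dF].
have [c cab] := deriv_mvt _ _ _ _ a1 dV.
have F2 : 0 < F c ^+ 2 by rewrite exprn_even_gt0//= F0.
rewrite -[_ *: _]/(_ * _) (_ : a + 1 - a = 1); last by ring.
rewrite mulr1 => E.
have : 8^-1 <= F c ^- 2 * f c.
  by rewrite mulrC ler_pdivlMr// mulrC; exact: hf.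
rewrite mulNr in E.
(* As [F] keeps its sign and [|F| >= 9], [1 / F] varies by less than [1 / 9], whereas it would have
   to drop by at least [1 / 8]. *)
have inv0 p : 9 <= p -> 0 < p^-1 <= (9^-1 : R).
  by move=> p9; rewrite invr_gt0 lef_pV2 ?posrE ?p9 ?andbT//; lra.
case: hF => h.
- have /andP[+ _] := inv0 _ (h _ aa2); have /andP[_] := inv0 _ (h _ aa1).
  by move: E; lra.
- have /andP[_ +] := inv0 (- F (a + 1)) ltac:(by have := h _ aa2; lra).
  have /andP[+ _] := inv0 (- F a) ltac:(by have := h _ aa1; lra).
  by rewrite !invrN; move: E; lra.
Qed.

(* Only the increment over [s + 1, s + 2] is required to be large: there
   [u (u - t) >= - t ^ 2 / 4] bounds the drift from below whatever the path
   does.  Bounded noise suffices on the first unit interval, to come down from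
   -oo, and on the third one, to explode. *)
Lemma forced_explosion sigma s M : 0 < sigma -> 0 <= s -> exists L, forall w,
  {within `[0, +oo[, continuous w} ->
  (forall r, s <= r <= s + 1 -> `|w r - w s| <= M) ->
  (forall r, s + 2 <= r <= s + 3 -> `|w r - w (s + 2)| <= M) ->
  L <= w (s + 2) - w (s + 1) ->
  forall x, (blowup_time sigma w s x < +oo)%E.
Proof.
move=> sigma0 s0; pose T := s + 3; pose B := T ^+ 2 / 4; pose m := sigma * M.
pose K := 2 * m + 9 + 4 * T.
(* The increment pays for the depth [2 * m + 9] left by the first interval, the noise [m] there,
   three losses of [B], and the target level [K]. *)
exists ((3 * m + 9 + 3 * B + K) / sigma) => w cw w1 w3 wL x.
apply/(explosionP _ _ _ s0 cw); apply: contrapT => noz.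
have cz := noise_continuous sigma w s s0 cw.
pose z := noise sigma w s.
have sT : s <= T by rewrite /T; lra.
have y0 r : s <= r <= T -> 0 < lin_y z s x r.
  by move=> /andP[sr _]; rewrite ltNge; apply/negP => yr; apply: noz; exists r.
have [cu uE] := noisy_sol_lin _ _ cz x T sT y0.
set u := lin_u _ _ _ _ in cu uE.
have cd : continuous (fun q => u q * (u q - q)).
  by apply: continuousM => //; exact: continuous_drift.
pose V r := x + prim (fun q => u q * (u q - q)) s r.
have dV r : is_derive r 1 V (u r * (u r - r)).
  rewrite -[X in is_derive _ _ _ X]add0r; apply: is_deriveD.
  exact: (is_derive_prim (fun r => u r * (u r - r))).
have uV r : s <= r <= T -> u r = V r + z r by move=> /uE.
have M0 : 0 <= M by apply: le_trans (normr_ge0 _) (w1 s _); lra.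
have m0 : 0 <= m by rewrite mulr_ge0// ltW.
have T0 : 0 <= T by rewrite /T; lra.
have B0 : 0 <= B by rewrite divr_ge0// sqr_ge0.
(* By completing the square, the drift is at least [- c ^ 2 / 4 >= - B]. *)
have Vlow a b : s <= a -> a <= b -> b <= T -> b <= a + 1 -> V a - B <= V b.
  move=> sa ab bT ba1.
  have [c /andP[ac cb]] := deriv_mvt _ _ _ _ ab (fun r _ => dV r) => E.
  have cB : c ^+ 2 / 4 <= B.
    rewrite ler_wpM2r// !expr2; apply: ler_pM => //; lra.
  have dB : - B <= u c * (u c - c).
    have := sqr_ge0 (u c - c / 2); move: cB; rewrite !expr2; nra.
  have : - B <= u c * (u c - c) * (b - a) by nra.
  by lra.
have zb1 r : s <= r <= s + 1 -> - m <= z r <= m.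
  move=> sr; rewrite -ler_norml /z noiseE; last by lra.
  by rewrite normrM gtr0_norm// /m ler_pM2l// w1.
have zb3 r : s + 2 <= r <= s + 3 -> - m <= z r - z (s + 2) <= m.
  move=> sr; rewrite -ler_norml /z !noiseE; [|lra|lra].
  rewrite -mulrBr normrM gtr0_norm// /m ler_pM2l//.
  rewrite (_ : _ - _ = w r - w (s + 2)); last by ring.
  exact: w3.
have zL : 3 * m + 9 + 3 * B + K <= z (s + 2) - z (s + 1).
  rewrite /z !noiseE; [|lra|lra].
  by move: wL; rewrite ler_pdivrMr//; lra.
(* If [V] stayed below [- (2 * m + 9)], then [u <= V / 2 < 0] and the drift would be at least
   [V ^ 2 / 4], against [quadratic_growth]; from any higher point [V] loses at most [B]. *)
have V1 : - (2 * m + 9) - B <= V (s + 1).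
  have [[r /andP[sr r1] Vr]|noV] := pselect (exists2 r, s <= r <= s + 1 & - (2 * m + 9) <= V r).
    by have := Vlow r (s + 1) sr r1; rewrite /T; lra.
  have Vneg r : s <= r <= s + 1 -> V r < - (2 * m + 9).
    by move=> sr; rewrite ltNge; apply/negP => Vr; apply: noV; exists r.
  case: (quadratic_growth V (fun r => u r * (u r - r)) s) => //.
  - move=> r sr; have rT : s <= r <= T by rewrite /T; lra.
    have := Vneg r sr; have := zb1 r sr; rewrite uV// !expr2.
    move: (V r) (z r) => v zr /andP[z1 z2] v1.
    have h : v + zr <= v / 2 by lra.
    have : (v / 2) * (v / 2) <= (v + zr) * (v + zr) by nra.
    have : 0 <= r * - (v + zr) by apply: mulr_ge0; lra.
    have : 0 <= v * v by rewrite -expr2 sqr_ge0.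
    by lra.
  - by right=> r /Vneg; lra.
(* With the noise recentred at [s + 2], [u] differs from [F] by at most [m], and [F >= K] yields
   [u >= F / 2] and [u - r >= F / 4]. *)
pose F r := V r + z (s + 2).
have F2 r : s + 2 <= r <= s + 3 -> K <= F r.
  move=> sr.
  have := Vlow (s + 1) (s + 2); have := Vlow (s + 2) r.
  have := zb1 (s + 1).
  rewrite /F /T; lra.
case: (quadratic_growth F (fun r => u r * (u r - r)) (s + 2)).
- move=> r _; rewrite -[X in is_derive _ _ _ X]addr0; exact: is_deriveD.
- move=> r sr; have sr' : s + 2 <= r <= s + 3 by lra.
  have rT : s <= r <= T by rewrite /T; lra.
  have := F2 r sr'; have := zb3 r sr'.
  have -> : u r = F r + (z r - z (s + 2)) by rewrite uV// /F; ring.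
  move: (F r) (z r - z (s + 2)) => v zr /andP[z1 z2]; rewrite /K => v1.
  have h1 : v / 2 <= v + zr by lra.
  have h2 : v / 4 <= v + zr - r by lra.
  have h3 : 0 <= v by lra.
  rewrite (_ : v ^+ 2 / 8 = (v / 2) * (v / 4)); last by field.
  by apply: ler_pM => //; lra.
- left=> r sr; have := F2 r; rewrite /K; lra.
Qed.

End Forced_explosion.

(** * Measurability of the explosion event *)

Section Measurability.
Context {R : realType} {d : measure_display} {Omega : measurableType d}.
Variables (W : R -> Omega -> R) (sigma s : R).
Hypotheses (s0 : 0 <= s)
  (mW : forall t, 0 <= t -> measurable_fun [set: Omega] (W t))
  (cW : forall omega, {within `[0, +oo[, continuous (W ^~ omega)}).

Let z omega := noise sigma (W ^~ omega) s.

Let cz omega : continuous (z omega).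
Proof. exact: noise_continuous. Qed.

Let mz t : measurable_fun [set: Omega] (z ^~ t).
Proof.
apply: measurable_funM => //; apply: measurable_funB; apply: mW => //.
by rewrite le_max s0.
Qed.

Lemma measurable_picard x n t : measurable_fun [set: Omega]
  (fun omega => picard (z omega) s (fun t => x + z omega t) n t).
Proof.
have ch omega : continuous (fun t => x + z omega t).
  by move=> r; apply: cvgD; [exact: cvg_cst|exact: cz].
have cp m omega := picard_continuous (z omega) s _ m (cz omega) (ch omega).
elim: n t => [|n IH] t /=; first exact: measurable_funD.
apply: measurable_funB.
  apply: (measurable_prim _ _ (fun r omega => (z omega r - r) *
    picard (z omega) s (fun t => x + z omega t) n r)) => [omega|r].
    exact: continuousM _ _ (continuous_drift _ (cz omega)) (cp _ _).
  by apply: measurable_funM => //; exact: measurable_funB.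
apply: measurable_funM => //.
by apply: (measurable_prim _ _ (fun r omega =>
  picard (z omega) s (fun t => x + z omega t) n r)).
Qed.

Lemma measurable_lin_y x t : s <= t ->
  measurable_fun [set: Omega] (fun omega => lin_y (z omega) s x t).
Proof.
move=> st; apply: measurable_funB => //.
have ch omega : continuous (fun t => x + z omega t).
  by move=> r; apply: cvgD; [exact: cvg_cst|exact: cz].
apply: (measurable_prim _ _ (fun r omega => lin_g (z omega) s x r)) => [omega|r].
  exact: lin_g_continuous.
have ms (q : R) : s <= q -> measurable_fun [set: Omega]
    (fun omega => lin_g (z omega) s x q).
  move=> sq; apply: (measurable_fun_cvg (h := fun N omega =>
    \sum_(0 <= i < N) picard (z omega) s (fun t => x + z omega t) i q)).
    by move=> N; apply: measurable_sum => i; exact: measurable_picard.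
  move=> omega _.
  by have [_ /(_ q sq) + _] := volterra_solP (z omega) s _ (cz omega) (ch omega).
(* The solution is frozen before [s], so times from [s] on cover all times. *)
have -> : (fun omega => lin_g (z omega) s x r) =
    (fun omega => lin_g (z omega) s x (Num.max s r)).
  by apply/funext => omega; rewrite /lin_g /volterra_sol maxA maxxx.
by apply: ms; rewrite le_max lexx.
Qed.

(** By [explosionP] the event says that [y] reaches []-oo, 0]]. By continuity and compactness this
    means that, in some bounded interval, [y] takes values below [1 / (k + 1)] at rational times for
    every [k]. *)
Lemma measurable_explosion x :
  measurable [set omega | (blowup_time sigma (W ^~ omega) s x < +oo)%E].
Proof.
pose Y omega t := lin_y (z omega) s x t.
have cY omega : continuous (Y omega) by exact: lin_y_continuous.
rewrite (_ : [set _ | _] = \bigcup_N \bigcap_k \bigcup_q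
  [set omega | s <= ratr q <= s + N%:R /\ Y omega (ratr q) < k.+1%:R^-1]).
  apply: bigcupT_measurable => N; apply: bigcapT_measurable => k.
  apply: bigcupT_measurable_rat => q.
  have [sq|sq] := boolP (s <= ratr q <= s + N%:R); last first.
    rewrite (_ : [set _ | _] = set0)//.
    by apply/seteqP; split => // omega [sq' _]; move/negP: sq; apply.
  rewrite (_ : [set _ | _] =
      [set: Omega] `&` (Y ^~ (ratr q)) @^-1` `]-oo, k.+1%:R^-1[).
    by apply: measurable_lin_y => //; case/andP: sq.
  apply/seteqP; split => omega /=; rewrite in_itv/=; first by move=> [].
  by move=> [_ yq]; split.
apply/seteqP; split => omega /=.
  move=> /explosionP -/(_ s0 (cW omega)) [t st yt].
  exists (Num.truncn (t - s)).+1 => // k _.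
  have yk : Y omega t < k.+1%:R^-1 by apply: le_lt_trans yt _.
  (* The rational is sought to the right of [t], so that it stays above [s]. *)
  have : \forall r \near t^'+, Y omega r < k.+1%:R^-1.
    by apply: (cvgr_lt (Y omega t)) => //; exact: cvg_at_right_filter (cY omega t).
  have tN : t < s + (Num.truncn (t - s)).+1%:R.
    by rewrite -ltrBlDl -truncn_lt_nat// subr_ge0.
  move=> yr; have [e /= e0 he] : nbhs t^'+ (fun r => Y omega r < k.+1%:R^-1) := yr.
  have tm : t < Num.min (t + e) (s + (Num.truncn (t - s)).+1%:R).
    by rewrite lt_min tN ltrDl e0.
  have [q] := rat_in_itvoo tm.
  rewrite in_itv/= lt_min => /and3P[tq qe qN].
  exists q => //=; split; first by rewrite (le_trans st (ltW tq)) ltW.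
  by apply: he => //=; rewrite distrC gtr0_norm ?subr_gt0// ltrBlDl.
move=> [N _ hN]; apply/explosionP => //.
have sN : s <= s + N%:R by rewrite lerDl.
(* If the minimum over the compact interval were positive, it would exceed [1 / (k + 1)] for the [k]
   taken from its inverse. *)
have [|c + cmin] := @EVT_min R (Y omega) s (s + N%:R) sN.
  exact: continuous_subspaceT.
rewrite in_itv/= => /andP[sc _]; exists c => //.
rewrite leNgt; apply/negP => yc.
pose k := Num.truncn (Y omega c)^-1.
have [q _ [/= sq]] := hN k I; apply/negP; rewrite -leNgt.
apply: (@le_trans _ _ (Y omega c)); last by apply: cmin; rewrite in_itv.
rewrite -[leRHS]invrK lef_pV2 ?posrE ?invr_gt0//.
by rewrite ltW// -truncn_lt_nat// invr_ge0 ltW.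
Qed.

End Measurability.

(** * Independence and the favourable event *)

Section Independence.
Context {R : realType} {d : measure_display} {T : measurableType d}.
Variables (P : probability T R) (n k : nat) (X : nat -> T -> R).
Hypotheses (kn : (k < n)%N)
  (mX : forall i, measurable_fun [set: T] (X i))
  (indX : forall A : nat -> set R, (forall i, measurable (A i)) ->
    P (\bigcap_(i < n) (X i @^-1` A i)) =
    (\prod_(i < n) P (X i @^-1` A i))%E).

(* The pi-system of the rectangles that do not constrain the [k]-th variable. *)
Definition rect_avoiding : set (set T) :=
  [set E | exists A : nat -> set R, [/\ forall i, measurable (A i),
    A k = setT & E = \bigcap_(i < n) (X i @^-1` A i)]].

Let mpre i (B : set R) : measurable B -> measurable (X i @^-1` B).
Proof. by move=> mB; rewrite -[_ @^-1` _]setTI; exact: mX. Qed.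

Let replace (A : nat -> set R) (B : set R) i := if i == k then B else A i.

Let bigcap_replace A B : A k = setT ->
  \bigcap_(i < n) (X i @^-1` A i) `&` X k @^-1` B =
  \bigcap_(i < n) (X i @^-1` replace A B i).
Proof.
move=> Ak; apply/seteqP; split => x /=.
  move=> [hA hB] i/= ni; rewrite /replace; case: eqP => [->//|_]; exact: hA.
move=> h; split.
  move=> i /= ni; have := h i ni; rewrite /replace; case: eqP => [->|//].
  by rewrite Ak.
by have := h k kn; rewrite /= /replace eqxx.
Qed.

Let prob_replace (A : nat -> set R) (B : set R) :
  (forall i, measurable (A i)) -> A k = setT ->
  measurable B ->
  P (\bigcap_(i < n) (X i @^-1` replace A B i)) =
  (P (\bigcap_(i < n) (X i @^-1` A i)) * P (X k @^-1` B))%E.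
Proof.
move=> mA Ak mB; rewrite !indX//; last first.
  by move=> i; rewrite /replace; case: eqP.
rewrite (bigD1 (Ordinal kn))//= [in RHS](bigD1 (Ordinal kn))//=.
rewrite /replace eqxx Ak preimage_setT probability_setT mul1e muleC.
congr (_ * _)%E; apply: eq_bigr => i ik.
by rewrite (_ : (nat_of_ord i == k) = false)//; apply/negbTE.
Qed.

(** As functions of [E], both sides are finite measures. They agree on the pi-system, by the product
    formula with [B] as [k]-th side, hence on the generated sigma-algebra. *)
Lemma independent_rect_avoiding E (B : set R) :
  <<s rect_avoiding >> E -> measurable B ->
  P (E `&` X k @^-1` B) = (P E * P (X k @^-1` B))%E.
Proof.
move=> sE mB; have mI := mpre k B mB.
have Pfin : P (X k @^-1` B) \is a fin_num by exact: fin_num_measure.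
pose r := NngNum (fine_ge0 (measure_ge0 P (X k @^-1` B))).
transitivity (mrestr P mI E) => //.
transitivity (mscale r P E); last by rewrite /mscale/= fineK// muleC.
have Gm : rect_avoiding `<=` measurable.
  move=> _ [A [mA _ ->]]; apply: bigcap_measurableType => i _; exact: mpre.
have GT : rect_avoiding setT.
  exists (fun=> setT); split=> //; apply/seteqP; split=> //.
apply: (g_sigma_algebra_measure_unique rect_avoiding Gm (fun=> setT)) sE => //.
- by rewrite bigcup_const//; exists 0%N.
- move=> _ _ [A [mA Ak ->]] [A' [mA' Ak' ->]].
  exists (fun i => A i `&` A' i); split.
  + by move=> i; exact: measurableI.
  + by rewrite Ak Ak' setTI.
  + apply/seteqP; split => x /=.
      by move=> [h h'] i ni; split; [exact: h|exact: h'].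
    by move=> h; split => i ni; have [] := h i ni.
- move=> _ [A [mA Ak ->]].
  have := prob_replace A B mA Ak mB; rewrite -bigcap_replace// => H.
  transitivity ((fine (P (X k @^-1` B)))%:E * P (\bigcap_(i < n) (X i @^-1` A i)))%E => //.
  by rewrite fineK// muleC; exact: H.
- move=> _; apply: (@le_lt_trans _ _ (P (X k @^-1` B))).
    have : (P (setT `&` X k @^-1` B) <= P (X k @^-1` B))%E by rewrite setTI.
    exact.
  by rewrite ltey_eq Pfin.
Qed.

Lemma measurable_rect_avoiding i : (i < n)%N -> i != k ->
  @measurable_fun _ _ (g_sigma_algebraType rect_avoiding) R setT (X i).
Proof.
move=> ni ik _ B mB; rewrite setTI; apply: sub_sigma_algebra.
exists (fun j => if j == i then B else setT); split.
- by move=> j; case: eqP.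
- by rewrite eq_sym (negbTE ik).
- apply/seteqP; split => x /=.
    by move=> xB j _ /=; case: eqP => [->|].
  by move=> /(_ i ni)/=; rewrite eqxx.
Qed.

End Independence.

Section Normal_tail.
Context {R : realType}.

(** The continuous positive density has a positive minimum on [[L, L + 1]]. *)
Lemma normal_prob_itv_gt0 (m sd L : R) : sd != 0 ->
  (0 < normal_prob m sd `[L, +oo[)%E.
Proof.
move=> sd0; have LL : L <= L + 1 by rewrite lerDl.
have [|c _ cmin] := @EVT_min R (normal_pdf m sd) L (L + 1) LL.
  exact/continuous_subspaceT/continuous_normal_pdf.
have c0 : 0 < normal_pdf m sd c.
  by rewrite normal_pdfE// mulr_gt0 ?normal_peak_gt0// expR_gt0.
have mpdf (D : set R) : measurable_fun D (fun x => (normal_pdf m sd x)%:E).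
  by apply/measurable_EFinP; apply: measurable_funTS; exact: measurable_normal_pdf.
apply: (@lt_le_trans _ _ (\int[lebesgue_measure]_(x in `[L, (L + 1)%R]) (normal_pdf m sd c)%:E)%E).
  rewrite integral_cst//= lebesgue_measure_itv/= lte_fin ltrDl ltr01.
  by rewrite -EFinB addrAC subrr add0r mule1 lte_fin.
apply: (@le_trans _ _ (\int[lebesgue_measure]_(x in `[L, (L + 1)%R]) (normal_pdf m sd x)%:E)%E).
  apply: ge0_le_integral => //.
  - by move=> x _; rewrite lee_fin ltW.
  - exact: mpdf.
apply: ge0_subset_integral => //.
- exact: mpdf.
- by move=> x _; rewrite lee_fin normal_pdf_ge0.
- by move=> x /=; rewrite !in_itv/= andbT => /andP[].
Qed.

End Normal_tail.

(** * Paths of bounded oscillation *)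

Section Bounded_oscillation.
Context {R : realType} {d : measure_display} {Omega : measurableType d}.
Variables (P : probability Omega R) (W : R -> Omega -> R).
Hypothesis hW : wiener_process P W.
Variable s : R.
Hypothesis s0 : 0 <= s.

Let mesh N : R := (2 ^ N)%:R^-1.

(* A subdivision of [s, s + 3] that is dyadic on the first and the last unit
   intervals and jumps over the middle one in a single step, the [2 ^ N]-th. *)
Let grid N i : R := if (i <= 2 ^ N)%N then s + i%:R * mesh N
  else s + 2 + (i - (2 ^ N).+1)%:R * mesh N.

Let grid_size N := ((2 ^ N).+1 + 2 ^ N)%N.

Let mesh_ge0 N : 0 <= mesh N. Proof. by rewrite invr_ge0. Qed.

Let mesh_full N : (2 ^ N)%:R * mesh N = 1.
Proof. by rewrite mulfV// pnatr_eq0 -lt0n expn_gt0. Qed.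

Let mesh_half N : mesh N = 2 * mesh N.+1.
Proof. by rewrite /mesh expnS natrM invfM mulrA mulfV// mul1r. Qed.

Let gridl N j : (j <= 2 ^ N)%N -> grid N j = s + j%:R * mesh N.
Proof. by rewrite /grid => ->. Qed.

Let gridr N j : grid N ((2 ^ N).+1 + j) = s + 2 + j%:R * mesh N.
Proof. by rewrite /grid leqNgt ltn_addr// addKn. Qed.

Let grid_step N i : grid N i <= grid N i.+1.
Proof.
have [iN|] := ltnP i (2 ^ N).
  by rewrite !gridl ?(ltnW iN)// lerD2l ler_wpM2r// ler_nat.
rewrite leq_eqVlt => /predU1P[<-|iN].
  rewrite gridl// -[(2 ^ N).+1]addn0 gridr mesh_full mul0r; lra.
rewrite -(subnKC iN) -addnS !gridr lerD2l ler_wpM2r// ler_nat.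
by [].
Qed.

Let grid_ge0 N i : 0 <= grid N i.
Proof.
elim: i => [|i IH]; first by rewrite gridl// mul0r addr0.
exact: le_trans (grid_step N i).
Qed.

Let incr N i : Omega -> R := W (grid N i.+1) \- W (grid N i).

Let mincr N i : measurable_fun [set: Omega] (incr N i).
Proof. by apply: measurable_funB; apply: (wiener_measurable hW). Qed.

(* The oscillation bound at the points of the [N]-th grid: an event that does not
   involve the increment over [s + 1, s + 2]. *)
Let small_at N (M : R) : set Omega := [set omega | forall j, (j <= 2 ^ N)%N ->
  `|W (s + j%:R * mesh N) omega - W s omega| <= M /\
  `|W (s + 2 + j%:R * mesh N) omega - W (s + 2) omega| <= M].

Let small_at_rect N M :
  <<s rect_avoiding (grid_size N) (2 ^ N) (incr N) >> (small_at N M).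
Proof.
set G := rect_avoiding _ _ _.
(* Differences from the block start [a] telescope into increments of that block, with indices all
   below [2 ^ N] for [a = 0] and all above for [a = 2 ^ N + 1]. *)
suff H a j : (j <= 2 ^ N)%N -> (a == 0%N) || (a == (2 ^ N).+1) ->
    <<s G >> ((fun omega => W (grid N (a + j)) omega - W (grid N a) omega) @^-1`
      `[- M, M]).
  rewrite (_ : small_at N M = \bigcap_(j in [set j | (j <= 2 ^ N)%N])
    ((fun omega => W (grid N (0 + j)) omega - W (grid N 0) omega) @^-1` `[- M, M]
    `&` (fun omega => W (grid N ((2 ^ N).+1 + j)) omega -
       W (grid N ((2 ^ N).+1 + 0)) omega) @^-1` `[- M, M])); last first.
    apply/seteqP; split => omega h j /= jN; have := h j jN;
      by rewrite /= !in_itv/= -!ler_norml !gridr add0n !gridl// !mul0r !addr0.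
  apply: (@bigcap_measurableType _ (g_sigma_algebraType G)) => j /= jN.
  apply: (@measurableI _ (g_sigma_algebraType G)); first exact: H.
  by rewrite [in W (grid N (_ + 0))]addn0; apply: H => //; rewrite eqxx orbT.
move=> jN aE.
rewrite (_ : (fun omega => _) = (fun omega => \sum_(i < j) incr N (a + i)%N omega)).
  rewrite -[_ @^-1` _]setTI.
  apply: (@measurable_sum _ (g_sigma_algebraType G) R setT) => //; last first.
  move=> i; apply: measurable_rect_avoiding.
    have := ltn_ord i; move: aE => /orP[] /eqP -> ij; rewrite /grid_size.
      by rewrite add0n ltn_addr// ltnS ltnW// (leq_trans ij).
    by rewrite ltn_add2l (leq_trans ij).
  have := ltn_ord i; move: aE => /orP[] /eqP -> ij.
    by rewrite add0n ltn_eqF// (leq_trans ij).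
  by rewrite gtn_eqF// addSn ltnS leq_addr.
apply/funext => omega.
rewrite -(big_mkord xpredT (fun i => incr N (a + i)%N omega)).
rewrite -(addn0 a) [in RHS]/incr.
under eq_bigr do rewrite /= addn0 -addnS.
by rewrite (telescope_sumr (fun i => W (grid N (a + i)%N) omega))//= addn0.
Qed.

Let sub_measurable N : <<s rect_avoiding (grid_size N) (2 ^ N) (incr N) >>
  `<=` measurable.
Proof.
apply: smallest_sub; first exact: sigma_algebra_measurable.
move=> _ [A [mA _ ->]]; apply: bigcap_measurableType => i _.
by rewrite -[_ @^-1` _]setTI; exact: mincr.
Qed.

Let msmall N M : measurable (small_at N M).
Proof. exact: sub_measurable (small_at_rect N M). Qed.

(** The dyadic grids are nested: point [j] of one is point [2 * j] of the next. *)
Let small_at_S N M : small_at N.+1 M `<=` small_at N M.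
Proof.
move=> omega h j jN; have := h (2 * j)%N; rewrite expnS leq_mul2l jN orbT.
by rewrite natrM mulrAC -mesh_half mulrC => /(_ isT).
Qed.

(** Restricting to dyadic points makes the event a countable intersection; path continuity recovers
    the whole intervals. *)
Definition bounded_osc M : set Omega := \bigcap_N small_at N M.

Lemma measurable_bounded_osc M : measurable (bounded_osc M).
Proof. by apply: bigcapT_measurable => N; exact: msmall. Qed.

(** Independence holds at each dyadic level and passes to the decreasing limit by continuity from
    above. *)
Lemma bounded_osc_indep M L :
  let Inc := (W (s + 2) \- W (s + 1)) @^-1` `[L, +oo[ in
  P (bounded_osc M `&` Inc) = (P (bounded_osc M) * P Inc)%E.
Proof.
move=> Inc.
have mInc : measurable Inc.
  rewrite -[Inc]setTI; apply: measurable_funB => //; apply: (wiener_measurable hW);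
    exact: addr_ge0.
have IncE N : Inc = incr N (2 ^ N) @^-1` `[L, +oo[.
  by rewrite /incr -[(2 ^ N).+1]addn0 gridr (gridl _ _ (leqnn _)) mesh_full mul0r addr0.
have step N : P (small_at N M `&` Inc) = (P (small_at N M) * P Inc)%E.
  rewrite (IncE N); apply: (@independent_rect_avoiding _ _ _ P (grid_size N)) => //.
  - by rewrite /grid_size leq_addr.
  - move=> A mA; apply: (wiener_independent hW) => //; exact: grid_step.
have nonincr (F : nat -> set Omega) : (forall N, F N.+1 `<=` F N) ->
    {homo F : n m / (n <= m)%N >-> (m <= n)%O}.
  move=> FS n m nm; apply/subsetPset; elim: m nm => [|m IH].
    by rewrite leqn0 => /eqP ->.
  rewrite leq_eqVlt => /predU1P[->//|]; rewrite ltnS => /IH.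
  exact: subset_trans (FS m).
have fin A : measurable A -> (P A < +oo)%E.
  by move=> mA; rewrite ltey_eq fin_num_measure.
have c1 : (fun N => P (small_at N M `&` Inc)) @ \oo --> P (bounded_osc M `&` Inc).
  rewrite (_ : _ `&` Inc = \bigcap_N (small_at N M `&` Inc)); last first.
    apply/seteqP; split => omega /=; first by move=> [h oI] N _; split => //; exact: h.
    by move=> h; split; [move=> N _; have [] := h N I|have [] := h 0%N I].
  apply: nonincreasing_cvg_mu.
  - by apply: fin; exact: measurableI.
  - by move=> N; exact: measurableI.
  - by apply: bigcapT_measurable => N; exact: measurableI.
  - by apply: nonincr => N; apply: setSI; exact: small_at_S.
have c2 : (fun N => P (small_at N M)) @ \oo --> P (bounded_osc M).
  apply: nonincreasing_cvg_mu => //; first exact: fin.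
  - exact: measurable_bounded_osc.
  - by apply: nonincr => N; exact: small_at_S.
have c3 : (fun N => (P (small_at N M) * P Inc)%E) @ \oo --> (P (bounded_osc M) * P Inc)%E.
  by apply: cvgeZr => //; exact: fin_num_measure.
have stepE : (fun N => P (small_at N M `&` Inc)) =
    (fun N => (P (small_at N M) * P Inc)%E) by exact/funext.
rewrite stepE in c1.
exact: (cvg_unique (@ereal_hausdorff R) c1 c3).
Qed.

Lemma bounded_osc_le M omega : bounded_osc M omega ->
  (forall r, s <= r <= s + 1 -> `|W r omega - W s omega| <= M) /\
  (forall r, s + 2 <= r <= s + 3 -> `|W r omega - W (s + 2) omega| <= M).
Proof.
move=> h; pose w r := W (Num.max 0 r) omega.
have cw : continuous w.
  apply: (continuous_comp_within _ (W ^~ omega) (fun r => Num.max 0 r)).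
  - exact: (wiener_continuous hW).
  - exact: max_continuous.
  - by move=> r; rewrite /= in_itv/= le_max lexx.
suff dyadic a : 0 <= a -> (forall N j, (j <= 2 ^ N)%N ->
    `|W (a + j%:R * mesh N) omega - W a omega| <= M) ->
    forall r, a <= r <= a + 1 -> `|W r omega - W a omega| <= M.
  split; first by apply: dyadic => // N j jN; have [] := h N I j jN.
  rewrite (_ : s + 3 = s + 2 + 1); last by ring.
  by apply: dyadic => [|N j jN]; [exact: addr_ge0|have [] := h N I j jN].
move=> a0 ha r /andP[ar ra].
have wE q : 0 <= q -> w q = W q omega by move=> q0; rewrite /w max_r.
rewrite -!wE//; last exact: le_trans ar.
rewrite leNgt; apply/negP => Mr.
have cf : {for r, continuous (fun q => `|w q - w a|)}.
  by apply: cvg_norm; apply: cvgB; [exact: cw|exact: cvg_cst].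
have [e /= e0 he] : nbhs r (fun q => M < `|w q - w a|).
  exact: (cvgr_gt `|w r - w a| cf).
(* Since [N < 2 ^ N], the mesh is below [e]; the [j] chosen next gives the last grid point not after
   [r], where [M] is still exceeded. *)
pose N := (Num.truncn e^-1).+1.
have Ne : mesh N < e.
  rewrite -[ltRHS]invrK ltf_pV2 ?posrE ?invr_gt0// ?ltr0n ?expn_gt0//.
  apply: (@lt_trans _ _ N%:R).
    by rewrite -truncn_lt_nat// invr_ge0 ltW.
  by rewrite ltr_nat ltn_expl.
pose j := Num.truncn ((r - a) * (2 ^ N)%:R).
have r0 : 0 <= (r - a) * (2 ^ N)%:R by rewrite mulr_ge0// subr_ge0.
have := truncn_itv r0; rewrite -/j => /andP[j1 j2].
have meshK c : c * (2 ^ N)%:R * mesh N = c by rewrite -mulrA mesh_full mulr1.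
have j1' : j%:R * mesh N <= r - a.
  by rewrite -(meshK (r - a)) ler_wpM2r.
have j2' : r - a < j%:R * mesh N + mesh N.
  rewrite -(meshK (r - a)) -[X in _ < _ + X]mul1r -mulrDl natr1.
  by rewrite ltr_pM2r// invr_gt0 ltr0n expn_gt0.
have jN : (j <= 2 ^ N)%N.
  rewrite -(ler_nat R); apply: le_trans j1 _; rewrite ler_piMl//; lra.
have aj0 : 0 <= a + j%:R * mesh N by rewrite addr_ge0// mulr_ge0.
have : M < `|w (a + j%:R * mesh N) - w a|.
  by apply: he; rewrite /ball/= ger0_norm; lra.
by rewrite !wE// ltNge ha.
Qed.

(** Continuous paths are bounded on [[0, s + 3]], so the events with integer [M] cover [Omega] and
    cannot all be null. *)
Lemma bounded_osc_prob_gt0 : exists M, (0 < P (bounded_osc M))%E.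
Proof.
apply: contrapT => H.
have P0 M : P (bounded_osc M) = 0%E.
  apply/eqP; rewrite eq_le measure_ge0 andbT leNgt; apply/negP => PM.
  by apply: H; exists M.
have cover : \bigcup_k bounded_osc k%:R = [set: Omega].
  apply/seteqP; split => // omega _.
  pose w r := W (Num.max 0 r) omega.
  have cw : continuous w.
    apply: (continuous_comp_within _ (W ^~ omega) (fun r => Num.max 0 r)).
    - exact: (wiener_continuous hW).
    - exact: max_continuous.
    - by move=> r; rewrite /= in_itv/= le_max lexx.
  have [K K0 hK] := continuous_segment_bounded w 0 (s + 3) cw.
  exists (Num.truncn (K + K)).+1 => // N _ j jN.
  have bnd p q : 0 <= p <= s + 3 -> 0 <= q <= s + 3 ->
      `|W p omega - W q omega| <= (Num.truncn (K + K)).+1%:R.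
    move=> p03 q03; have := hK p p03; have := hK q q03.
    rewrite /w !max_r; [|by case/andP: p03|by case/andP: q03].
    move=> hq hp; apply: (@le_trans _ _ (K + K)).
      by apply: le_trans (ler_normB _ _) _; rewrite lerD.
    by apply: ltW; rewrite -truncn_lt_nat// addr_ge0// ltW.
  have jm0 : 0 <= j%:R * mesh N by rewrite mulr_ge0.
  have jm1 : j%:R * mesh N <= 1.
    by rewrite -[leRHS](mesh_full N) ler_wpM2r// ler_nat.
  move: (j%:R * mesh N) jm0 jm1 => q q0 q1.
  have s0' : 0 <= s by [].
  by split; apply: bnd; lra.
have : P.-negligible [set: Omega].
  rewrite -cover; apply: negligible_bigcup => k.
  by apply: (negligibleP _ (measurable_bounded_osc k%:R)).2; exact: P0.
move=> /(negligibleP _ measurableT) PT0.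
have : P [set: Omega] = 0%E by exact: PT0.
by rewrite probability_setT => /eqP; rewrite eqe oner_eq0.
Qed.

End Bounded_oscillation.

(** * Positivity of the explosion probability from minus infinity *)

Theorem theorem4p8 (R : realType) (d : measure_display)
    (Omega : measurableType d) (P : probability Omega R)
    (W : R -> Omega -> R) (hW : wiener_process P W)
    (sigma : R) (hsigma : 0 < sigma) (s : R) (hs : 0 <= s) :
  (0 < blowup_prob_ninfty P W sigma s)%E.
Proof.
have cW := wiener_continuous hW.
pose E x := [set omega | (blowup_time sigma (W ^~ omega) s x < +oo)%E].
have mE x : measurable (E x).
  by apply: measurable_explosion => //; exact: wiener_measurable hW.
have Emono x x' : x <= x' -> E x `<=` E x'.
  by move=> xx' omega; exact: explosion_nondecreasing.
have [M PM] := bounded_osc_prob_gt0 P W hW s hs.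
have [L forced] := forced_explosion sigma s M hsigma hs.
pose I := (W (s + 2) \- W (s + 1)) @^-1` `[L, +oo[.
have s1 : 0 <= s + 1 by exact: addr_ge0.
have s2 : 0 <= s + 2 by exact: addr_ge0.
have mI : measurable I.
  rewrite -[I]setTI; apply: measurable_funB => //; exact: wiener_measurable hW _ _.
have PI : (0 < P I)%E.
  rewrite /I (wiener_normal hW) ?ltrD2l ?ltr1n//.
  apply: normal_prob_itv_gt0; rewrite sqrtr_eq0 -ltNge; lra.
have mG := measurableI _ _ (measurable_bounded_osc P W hW s hs M) mI.
(* The favourable event does not depend on [x], so its probability is a lower bound uniform in
   [x]. *)
have GE x : bounded_osc W s M `&` I `<=` E x.
  move=> omega [/(bounded_osc_le P W hW s hs)[w1 w3] oI].
  apply: forced => //; move: oI; by rewrite /I /= in_itv/= andbT.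
have PGE x : (P (bounded_osc W s M `&` I) <= blowup_prob P W sigma s x)%E.
  by apply: le_measure; [rewrite inE|rewrite inE; exact: mE|exact: GE].
apply: (@lt_le_trans _ _ (P (bounded_osc W s M `&` I))).
  by rewrite bounded_osc_indep// mule_gt0.
apply: lime_ge; last exact: nearW.
(* The bound passes to [lim] only if the limit exists; monotonicity, read through [- x], gives
   convergence at [-oo]. *)
have : nonincreasing_fun (fun x => blowup_prob P W sigma s (- x)).
  move=> x y xy; apply: le_measure; rewrite ?inE; [exact: mE|exact: mE|].
  by apply: Emono; rewrite lerN2.
move=> /nonincreasing_cvge /cvgNy_compNP cvgB.
by apply/cvg_ex; eexists; exact: cvgB.
Qed.
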